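(* Let $\lambda$ be a positive integer and let $k\in\{2,3,4,5\}$. Then the Poisson distribution of order $k$ with parameter $\lambda$ has a unique mode, namely \[ m_{k,\lambda}=\frac{\lambda k(k+1)}{2}-\left\lfloor \frac{k}{2}\right\rfloor, \] i.e., $f_k(x;\lambda)$ attains its maximum over $x\in\{0,1,2,\dots\}$ at exactly one point, which is $x=\lambda k(k+1)/2-\lfloor k/2\rfloor$.
   Context: For a positive integer $k$ and real $\lambda>0$, the Poisson distribution of order $k$ with parameter $\lambda$ is the distribution on $\{0,1,2,\dots\}$ with probability mass function \[ f_k(x;\lambda)=\sum e^{-k\lambda}\frac{\lambda^{x_1+x_2+\cdots+x_k}}{x_1!\,x_2!\cdots x_k!},\qquad x=0,1,2,\dots, \] where the sum is over all $k$-tuples $(x_1,\dots,x_k)$ of nonnegative integers with $x_1+2x_2+\cdots+kx_k=x$. Equivalently, its probability generating function is $\sum_{x\ge0}f_k(x;\lambda)s^x=e^{\lambda(-k+s+s^2+\cdots+s^k)}$. A mode is a value of $x$ at which $f_k(x;\lambda)$ is maximal. $\lfloor u\rfloor$ denotes the greatest integer not exceeding $u$. *)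

(* Defs.v *)
From HB Require Import structures.
From mathcomp Require Import all_boot all_order all_algebra.
From mathcomp Require Import reals.
From mathcomp Require Import sequences exp.
Set Implicit Arguments. Unset Strict Implicit. Unset Printing Implicit Defensive.
Import Order.TTheory GRing.Theory Num.Theory.
Local Open Scope ring_scope.

(* Poisson distribution of order k with parameter lam, pmf at x:
   f_k(x;lam) = sum over k-tuples (x_1,..,x_k) of nonnegative integers with
   x_1 + 2 x_2 + ... + k x_k = x of e^{-k lam} lam^{x_1+..+x_k}/(x_1!...x_k!).
   The tuple is encoded as t : {ffun 'I_k -> 'I_(x.+1)} (index i stands for
   x_{i+1}); the bound x_i <= x is automatic from the constraint, so no
   tuple is lost. *)
Definition poisson_order_pmf (R : realType) (k : nat) (lam : R) (x : nat) : R :=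
  \sum_(t : {ffun 'I_k -> 'I_x.+1} | (\sum_(i < k) i.+1 * t i)%N == x)
     expR (- (k%:R * lam)) * lam ^+ (\sum_(i < k) (t i : nat))%N
       / (\prod_(i < k) (t i)`!)%:R.

(* Main.v *)
(* Write p_x for the pmf without its factor e^{-k lam}, d_x = p_x - p_{x-1},
   K = k(k+1)/2, S = 1^2 + ... + k^2 and r = lam K - x.  The generating function gives
   x p_x = lam sum_j j p_{x-j}.  Beyond lam K this makes p_x a weighted sum of its
   predecessors with total weight lam K / x < 1, so no mode lies there.

   For large lam one shows D_x := S lam d_x - (r - c) p_x >= 0 by strong induction on x,
   for a constant c less than floor(k/2), the value of r at the mode; hence p increases
   up to the mode.  With w_i = (i+1) + ... + k the recursion reads
   sum_i w_i d_{x-i} = (r / lam) p_x, and its difference at consecutive x reads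
   x d_x = lam sum_j j d_{x-j} - p_{x-1}.  Adding th times the second to the first, with
   th = w_1, expresses D_x through D_{x-1}, ..., D_{x-k} with nonnegative coefficients,
   plus an explicit remainder which is nonnegative once lam is large.  The few terms
   between the mode and lam K are then compared using the first identity at x = lam K
   and x = lam K - 1.

   Finitely many lam remain for each k, and are settled by rigorous integer enclosures
   of multiples of p_x. *)
Require Import Defs.
From HB Require Import structures.
From Stdlib Require Import NArith.
From mathcomp Require Import all_boot all_order all_algebra.
From mathcomp Require Import reals.
From mathcomp Require Import sequences exp.
From mathcomp Require Import ring lra zify.
Import Order.TTheory GRing.Theory Num.Theory.
Local Open Scope ring_scope.
Set Implicit Arguments. Unset Strict Implicit. Unset Printing Implicit Defensive.

(** * Truncated generating polynomials and the recursion for the weights *)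

Section GeneratingPolynomial.
Variables (R : numFieldType) (lam : R).

(** Truncation of the series exp(lam X^(i+1)), so that the generating function becomes a
    polynomial. *)
Definition exp_factor (N i : nat) : {poly R} :=
  \sum_(n < N.+1) (lam ^+ n / n`!%:R) *: 'X^(i.+1 * n).

Definition gen_poly (k N : nat) : {poly R} := \prod_(i < k) exp_factor N i.

(** Truncation order x is already exact for the coefficient of X^x, by [coef_gen_poly_ge]. *)
Definition poisson_weight (k x : nat) : R := (gen_poly k x)`_x.

Lemma coef_gen_poly k N x : (gen_poly k N)`_x =
  \sum_(t : {ffun 'I_k -> 'I_N.+1} | (\sum_(i < k) i.+1 * t i)%N == x)
     lam ^+ (\sum_(i < k) (t i : nat))%N / (\prod_(i < k) (t i)`!)%:R.
Proof.
rewrite /gen_poly /exp_factor bigA_distr_bigA coef_sum big_mkcond [RHS]big_mkcond.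
apply: eq_bigr => t _.
rewrite scaler_prod -expr_sum coefZ coefXn /= big_split /= -expr_sum.
by rewrite prodfV natr_prod [x == _]eq_sym; case: eqP; rewrite ?mulr1 ?mulr0.
Qed.

Lemma coefM_congr n (p q u : {poly R}) :
  (forall y, (y <= n)%N -> p`_y = q`_y) ->
  forall y, (y <= n)%N -> (p * u)`_y = (q * u)`_y.
Proof.
move=> pq y yn; rewrite !coefM; apply: eq_bigr => i _.
by rewrite pq // (leq_trans _ yn) // -ltnS.
Qed.

Lemma coef_exp_factorS N i y : (y <= N)%N ->
  (exp_factor N.+1 i)`_y = (exp_factor N i)`_y.
Proof.
move=> yN; rewrite /exp_factor big_ord_recr /= coefD coefZ coefXn.
by rewrite ltn_eqF ?mulr0 ?addr0 // mulSn (leq_trans _ (leq_addr _ _)).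
Qed.

Lemma coef_gen_polyS k N y : (y <= N)%N ->
  (gen_poly k N.+1)`_y = (gen_poly k N)`_y.
Proof.
rewrite /gen_poly; elim: k y => [|k IH] y yN; first by rewrite !big_ord0.
rewrite !big_ord_recr /= (coefM_congr _ IH yN) mulrC [in RHS]mulrC.
by apply: coefM_congr yN => z zN; exact: coef_exp_factorS.
Qed.

Lemma coef_gen_poly_ge k N y : (y <= N)%N ->
  (gen_poly k N)`_y = poisson_weight k y.
Proof.
move=> /subnKC <-; elim: (N - y)%N => [|d IH]; first by rewrite addn0.
by rewrite addnS coef_gen_polyS ?leq_addr.
Qed.

Lemma deriv_exp_factor N i :
  (exp_factor N.+1 i)^`() = (lam *+ i.+1) *: 'X^i * exp_factor N i.
Proof.
have d1 : (1 : {poly R})^`() = 0 by exact: derivC.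
rewrite /exp_factor raddf_sum big_ord_recl muln0 expr0 /= derivZ d1.
rewrite scaler0 add0r mulr_sumr; apply: eq_bigr => n _.
have e : (i.+1 * n.+1).-1 = (i + i.+1 * n)%N by rewrite mulnS.
rewrite derivZ derivXn /bump leq0n add1n e exprD -scalerAl.
rewrite -scaler_nat scalerA -scalerAr scalerA; congr (_ *: _).
rewrite factS exprS !natrM -[lam *+ _]mulr_natr.
have n0 : n.+1%:R != 0 :> R by rewrite pnatr_eq0.
have f0 : n`!%:R != 0 :> R by rewrite pnatr_eq0 -lt0n fact_gt0.
move: (n.+1%:R : R) (n`!%:R : R) n0 f0 => a b a0 b0; by field; rewrite a0 b0.
Qed.

(** The differential equation G' = lam (1 + 2X + ... + k X^(k-1)) G of the generating function.
    Differentiating a factor costs one order of truncation, so it is claimed only up to degree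
    [N]. *)
Lemma coef_deriv_gen_poly k N y : (y <= N)%N ->
  (gen_poly k N.+1)^`()`_y =
  ((\sum_(i < k) (lam *+ i.+1) *: 'X^i) * gen_poly k N)`_y.
Proof.
have fE i z : (z <= N)%N -> (exp_factor N.+1 i)`_z = (exp_factor N i)`_z.
  exact: coef_exp_factorS.
elim: k y => [|k IH] y yN.
  by rewrite /gen_poly !big_ord0 mul0r derivC.
rewrite {1}/gen_poly big_ord_recr derivM coefD -/(gen_poly k N.+1).
rewrite (coefM_congr _ IH yN) deriv_exp_factor.
have gE z : (z <= N)%N -> (gen_poly k N.+1)`_z = (gen_poly k N)`_z.
  exact: coef_gen_polyS.
rewrite (coefM_congr _ gE yN) mulrC (coefM_congr _ (fE k) yN) -coefD.
rewrite big_ord_recr /= [gen_poly k.+1 N]/gen_poly big_ord_recr -/(gen_poly k N) /=.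
by apply: (congr1 (fun p : {poly R} => p`_y)); ring.
Qed.

Lemma poisson_weight0 k : poisson_weight k 0 = 1.
Proof.
rewrite /poisson_weight -horner_coef0 horner_prod big1 // => i _.
by rewrite /exp_factor big_ord1 hornerZ muln0 !expr0 hornerC divr1 mulr1.
Qed.

Lemma poisson_weight_rec k x :
  x.+1%:R * poisson_weight k x.+1 =
  lam * \sum_(i < k) i.+1%:R * (if (x < i)%N then 0 else poisson_weight k (x - i)).
Proof.
rewrite mulr_natl {1}/poisson_weight -coef_deriv coef_deriv_gen_poly //.
rewrite mulr_suml coef_sum mulr_sumr; apply: eq_bigr => i _.
rewrite -scalerAl coefZ coefXnM -[lam *+ _]mulr_natr mulrA.
by case: ltnP => // ix; rewrite coef_gen_poly_ge ?leq_subr.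
Qed.

End GeneratingPolynomial.

(** * Positivity, and absence of modes beyond lam K *)

Section Mode.
Variables (R : realFieldType) (k lam : nat).
Hypotheses (k_gt0 : (0 < k)%N) (lam_gt0 : (0 < lam)%N).
Local Notation L := (lam%:R : R).
Local Notation h := (poisson_weight L k).

Lemma poisson_weight_gt0 x : 0 < h x.
Proof.
elim/ltn_ind: x => -[|x] IH; first by rewrite poisson_weight0.
rewrite -(pmulr_rgt0 _ (ltr0Sn R x)) poisson_weight_rec mulr_gt0 ?ltr0n //.
case: k k_gt0 IH => // k' _ IH; rewrite big_ord_recl subn0 mul1r.
rewrite ltr_wpDr ?IH //; apply: sumr_ge0 => i _; rewrite mulr_ge0 ?ler0n //.
by case: ifP => // _; rewrite ltW // IH // ltnS leq_subr.
Qed.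

Lemma poisson_weight_mode m :
  (forall x, (x <= lam * \sum_(i < k) i.+1)%N -> x != m -> h x < h m) ->
  forall x, x != m -> h x < h m.
Proof.
move=> small; elim/ltn_ind => x IH xm.
have [/small->//|] := leqP x (lam * \sum_(i < k) i.+1)%N.
case: x IH xm => // x IH xm xgt.
rewrite -(ltr_pM2l (ltr0Sn R x)) poisson_weight_rec.
apply: le_lt_trans (_ : (lam * \sum_(i < k) i.+1)%:R * h m < _); last first.
  by rewrite ltr_pM2r ?poisson_weight_gt0 // ltr_nat.
rewrite natrM natr_sum -mulrA ler_wpM2l ?ler0n // mulr_suml.
apply: ler_sum => i _; rewrite ler_wpM2l ?ler0n //.
case: ifP => _; first by rewrite ltW ?poisson_weight_gt0.
have [->//|/IH e] := eqVneq (x - i)%N m.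
by rewrite ltW // e // ltnS leq_subr.
Qed.

End Mode.

(** * The drift inequality on zero-padded weights *)

Section Padding.
Variables (R : realFieldType) (k lam : nat).
Local Notation L := (lam%:R : R).
Local Notation h := (poisson_weight L k).

(* Shifted by 6 so that p_{x-1}, ..., p_{x-6} vanish for negative indices. *)
Definition padded_weight (n : nat) : R := if (n < 6)%N then 0 else h (n - 6).

(** Padding absorbs the range test of [poisson_weight_rec] and also covers x = 0, where both sides
    vanish. *)
Lemma padded_weight_rec x : (k <= 5)%N -> x%:R * padded_weight (6 + x) =
  L * \sum_(i < k) i.+1%:R * padded_weight (5 + x - i).
Proof.
move=> k5; rewrite /padded_weight ltnNge leq_addr /= addnC addnK.
case: x => [|x].
  rewrite mul0r big1 ?mulr0 // => i _.
  by rewrite addn0 ltnS (leq_trans (leq_subr _ _)) // mulr0.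
rewrite poisson_weight_rec; congr (_ * _); apply: eq_bigr => i _; congr (_ * _).
have i5 : (i <= 5)%N by rewrite (leq_trans (ltnW (ltn_ord i))).
have -> : (5 + x.+1 - i < 6)%N = (x < i)%N by lia.
by have -> : (5 + x.+1 - i - 6 = x - i)%N by lia.
Qed.

End Padding.

(* All k <= 5 at once: b_j is j for j <= k and 0 for j > k, L stands for lam,
   and s_i, H_i below for p_{x-i} and D_{x-i} >= 0. *)
Section Drift.
Variables (R : realFieldType) (b1 b2 b3 b4 b5 th mu c L : R).

Let w4 := b5.
Let w3 := b4 + w4.
Let w2 := b3 + w3.
Let w1 := b2 + w2.
Let w0 := b1 + w1.
Let S := w0 + w1 + w2 + w3 + w4.
Let W0 := w1 + w2 + w3 + w4.
Let T0 := w1 + 2 * w2 + 3 * w3 + 4 * w4.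
(* Coefficients of sum_j j b_j (s_1 - s_j) in terms of the differences of s. *)
Let v4 := 5 * b5.
Let v3 := 4 * b4 + v4.
Let v2 := 3 * b3 + v3.
Let v1 := 2 * b2 + v2.
(* S L F >= C0 D_x + P s_0 + Q s_1 for the remainder F of the identity for D_x.  The
   constant mu bounds th v_i by mu w_{i-1}, so that the identity
   sum_i w_{i-1} d_{x-i} = ((r + 1) / L) s_1 controls the negative terms of F. *)
Let C0 r := (r - c) * W0 + T0.
Let C1 r := (r - c) * (W0 - w1) + mu * w0 - th * v1 + (T0 - w1).
Let P r := C0 r * (r - c) + (S * c - T0) * S * L.
Let Q r := C1 r * (r + 1 - c) - mu * S * (r + 1).

Hypotheses (b1_ge0 : 0 <= b1) (b2_ge0 : 0 <= b2) (b3_ge0 : 0 <= b3).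
Hypotheses (b4_ge0 : 0 <= b4) (b5_ge0 : 0 <= b5).
Hypotheses (th_ge0 : 0 <= th) (mu_ge0 : 0 <= mu).
Hypotheses (th1 : w1 <= th * b1) (th2 : w2 <= th * b2).
Hypotheses (th3 : w3 <= th * b3) (th4 : w4 <= th * b4).
Hypotheses (mu1 : th * v1 <= mu * w0) (mu2 : th * v2 <= mu * w1).
Hypotheses (mu3 : th * v3 <= mu * w2) (mu4 : th * v4 <= mu * w3).
Hypotheses (L_gt0 : 0 < L) (S_gt0 : 0 < S).

(** Exactly what refutes D_x < 0: P >= 0 allows replacing s_0 by its lower bound s_1 + D_x / (S L),
    P + Q >= 0 discards the resulting multiple of s_1, and the last condition gives the remaining
    multiple of D_x the contradictory sign. *)
Definition drift_cond (r : R) : Prop :=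
  [/\ c <= r, 0 <= P r, 0 <= P r + Q r
    & P r < S * L * (S * (w0 * L + th * (w0 * L - r)) - C0 r)].

Lemma drift_step (r s0 s1 s2 s3 s4 s5 s6 : R) :
  drift_cond r ->
  0 <= s0 -> 0 <= s1 -> 0 <= s2 -> 0 <= s3 -> 0 <= s4 -> 0 <= s5 ->
  (w0 * L - r) * s0 = L * (b1 * s1 + b2 * s2 + b3 * s3 + b4 * s4 + b5 * s5) ->
  (w0 * L - r - 1) * s1 = L * (b1 * s2 + b2 * s3 + b3 * s4 + b4 * s5 + b5 * s6) ->
  (r + 1 - c) * s1 <= S * L * (s1 - s2) ->
  (r + 2 - c) * s2 <= S * L * (s2 - s3) ->
  (r + 3 - c) * s3 <= S * L * (s3 - s4) ->
  (r + 4 - c) * s4 <= S * L * (s4 - s5) ->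
  (r + 5 - c) * s5 <= S * L * (s5 - s6) ->
  (r - c) * s0 <= S * L * (s0 - s1).
Proof.
case=> r_ge; rewrite /P /Q; set C0r := C0 r; set C1r := C1 r.
set Pr := (X in 0 <= X -> _); set Qr := (X in Pr + X) => P_ge0 PQ_ge0 P_lt.
move=> s0p s1p s2p s3p s4p s5p rec0 rec1 H1 H2 H3 H4 H5.
have rc : 0 <= r - c by rewrite subr_ge0.
have SL_gt0 : 0 < S * L by rewrite mulr_gt0.
(* Since r >= c, the earlier drift inequalities make the sequence nondecreasing there; this signs
   the differences in [F]. *)
have d_ge0 i u v : 0 <= i -> 0 <= u -> (r + i - c) * u <= S * L * (u - v) -> v <= u.
  move=> i0 u0 Huv; rewrite -subr_ge0 -(pmulr_rge0 _ SL_gt0); apply: le_trans Huv.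
  by apply: mulr_ge0 => //; rewrite -addrA addrCA addr_ge0 ?subr_ge0.
have d2 : s3 <= s2 by apply: d_ge0 H2.
have d3 : s4 <= s3 by apply: d_ge0 H3.
have d4 : s5 <= s4 by apply: d_ge0 H4.
have d5 : s6 <= s5 by apply: d_ge0 H5.
pose D0 := S * L * (s0 - s1) - (r - c) * s0.
pose F := C0r * (s0 - s1) + (C1r - mu * w0) * (s1 - s2)
  + ((r - c) * (w3 + w4) + 3 * w3 + 4 * w4 - th * v2) * (s2 - s3)
  + ((r - c) * w4 + 4 * w4 - th * v3) * (s3 - s4)
  - th * v4 * (s4 - s5) + (S * c - T0) * s0.
(* The coefficients th b_j - w_j of the earlier drifts are nonnegative by [th1] to [th4]. *)
have idD : (w0 * L + th * (w0 * L - r)) * D0 = L *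
  ((th * b1 - w1) * (S * L * (s1 - s2) - (r + 1 - c) * s1)
   + (th * b2 - w2) * (S * L * (s2 - s3) - (r + 2 - c) * s2)
   + (th * b3 - w3) * (S * L * (s3 - s4) - (r + 3 - c) * s3)
   + (th * b4 - w4) * (S * L * (s4 - s5) - (r + 4 - c) * s4)
   + th * b5 * (S * L * (s5 - s6) - (r + 5 - c) * s5) + F).
  apply/eqP; rewrite -subr_eq0; apply/eqP.
  (* The difference of the two sides is this combination of the recursions at x and x - 1. *)
  transitivity ((S * L + th * (S * L - (r - c))) * ((w0 * L - r) * s0
         - L * (b1 * s1 + b2 * s2 + b3 * s3 + b4 * s4 + b5 * s5))
    - th * S * L * ((w0 * L - r - 1) * s1
         - L * (b1 * s2 + b2 * s3 + b3 * s4 + b4 * s5 + b5 * s6))).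
    by rewrite /D0 /F /C1r /C0r /C1 /C0 /S /v1 /v2 /v3 /v4 /T0 /W0 /w0 /w1 /w2 /w3 /w4; ring.
  by rewrite rec0 rec1 !subrr !mulr0 subr0.
have leF : L * F <= (w0 * L + th * (w0 * L - r)) * D0.
  by rewrite idD ler_pM2l // lerDr !addr_ge0 // mulr_ge0 ?subr_ge0 // mulr_ge0.
have idV : L * (w0 * (s1 - s2) + w1 * (s2 - s3) + w2 * (s3 - s4) + w3 * (s4 - s5)
    + w4 * (s5 - s6)) = (r + 1) * s1.
  apply/eqP; rewrite -subr_eq0; apply/eqP.
  have -> : (r + 1) * s1 = w0 * L * s1 - (w0 * L - r - 1) * s1 by ring.
  by rewrite rec1 /w0 /w1 /w2 /w3 /w4; ring.
have geF : C0r * (S * L * (s0 - s1)) + C1r * (S * L * (s1 - s2))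
    + (S * c - T0) * S * L * s0 - mu * S * (r + 1) * s1 <= S * (L * F).
  rewrite -subr_ge0 -[mu * S * _ * _]mulrA -idV.
  rewrite [X in 0 <= X](_ : _ = S * L * (((r - c) * (w3 + w4) + 3 * w3 + 4 * w4
      + (mu * w1 - th * v2)) * (s2 - s3) + ((r - c) * w4 + 4 * w4
      + (mu * w2 - th * v3)) * (s3 - s4) + (mu * w3 - th * v4) * (s4 - s5)
      + mu * w4 * (s5 - s6))); last by rewrite /F; ring.
  have w4p : 0 <= w4 by [].
  have w3p : 0 <= w3 by rewrite addr_ge0.
  by rewrite !(ltW L_gt0, ltW S_gt0, rc, subr_ge0, mulr_ge0, addr_ge0) ?ler0n.
have C1_ge0 : 0 <= C1r.
  have -> : C1r =
      (r - c) * (w2 + w3 + w4) + (mu * w0 - th * v1) + (2 * w2 + 3 * w3 + 4 * w4).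
    by rewrite /C1r /C1 /W0 /T0; ring.
  have w3p : 0 <= w3 by rewrite addr_ge0.
  have w2p : 0 <= w2 by rewrite addr_ge0.
  have w4p : 0 <= w4 by [].
  by rewrite !(rc, subr_ge0, mulr_ge0, addr_ge0) ?ler0n.
rewrite -subr_ge0 -/D0 leNgt; apply/negP => D0_lt0.
have G : C0r * D0 + Pr * s0 + Qr * s1 <= S * (w0 * L + th * (w0 * L - r)) * D0.
  rewrite -mulrA; apply: le_trans (_ : S * (L * F) <= _); last by rewrite ler_pM2l.
  apply: le_trans geF.
  have := ler_wpM2l C1_ge0 H1.
  by rewrite /Pr /Qr /D0; clearbody C0r C1r S T0; lra.
have s01 : S * L * s1 + D0 <= S * L * s0.
  by have := mulr_ge0 rc s0p; rewrite /D0; clearbody S; lra.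
have := mulr_ge0 PQ_ge0 (mulr_ge0 (ltW SL_gt0) s1p).
have := ler_wpM2l P_ge0 s01.
have := ler_wpM2l (ltW SL_gt0) G.
have : 0 < (S * L * (S * (w0 * L + th * (w0 * L - r)) - C0r) - Pr) * - D0.
  by rewrite mulr_gt0 ?subr_gt0 ?oppr_gt0 //.
clearbody D0 Pr Qr C0r; lra.
Qed.

Lemma drift_bound (rm : R) (s : nat -> R) :
  0 <= c <= rm -> (forall r, rm <= r -> r <= w0 * L - 1 -> drift_cond r) ->
  (forall n, (n <= 5)%N -> s n = 0) -> (forall n, 0 <= s n) ->
  (forall x : nat, x%:R * s (6 + x)%N =
     L * (b1 * s (5 + x)%N + b2 * s (4 + x)%N + b3 * s (3 + x)%N
          + b4 * s (2 + x)%N + b5 * s (1 + x)%N)) ->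
  forall n, rm <= w0 * L + 5 - n%:R ->
    (w0 * L + 5 - n%:R - c) * s n.+1 <= S * L * (s n.+1 - s n).
Proof.
move=> /andP[c0 crm] cond s0 sp rec; elim/ltn_ind => n IH rn.
have [n4|] := leqP n 4; first by rewrite !s0 ?(leqW n4) ?mulr0 ?subr0 ?mulr0.
case: n IH rn => // -[|[|[|[|x]]]] // IH rn _.
case: x IH rn => [|x] IH rn.
  (* First nonzero index: the predecessor is padding, so the claim reduces to w0 L - c <= S L, from
     c >= 0 and w0 <= S. *)
  rewrite [s 5]s0 // subr0 ler_wpM2r // addrK.
  apply: le_trans (_ : w0 * L <= _); first by rewrite lerBlDr lerDl.
  rewrite ler_wpM2r ?(ltW L_gt0) // -subr_ge0.
  have -> : S - w0 = w1 + w2 + w3 + w4 by rewrite /S; ring.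
  by rewrite !addr_ge0.
have natE (m : nat) : (m + x)%:R = m%:R + x%:R :> R by rewrite natrD.
rewrite -[x.+1.+4.+1]/(6 + x)%N -[x.+1.+4.+2]/(7 + x)%N natE in rn *.
rewrite (_ : w0 * L + 5 - _ = w0 * L - 1 - x%:R); last by ring.
have {}rn : rm <= w0 * L - 1 - x%:R.
  by move: rn; rewrite (_ : w0 * L + 5 - _ = w0 * L - 1 - x%:R) //; ring.
have IHi i : (i <= 5)%N ->
    (w0 * L - 1 - x%:R + (5 - i)%N.+1%:R - c) * s (i.+1 + x)%N <=
    S * L * (s (i.+1 + x)%N - s (i + x)%N).
  move=> i5; have := IH (i + x)%N.
  have -> : w0 * L + 5 - (i + x)%:R = w0 * L - 1 - x%:R + (5 - i)%N.+1%:R.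
    by rewrite -[(5 - i)%N.+1]addn1 !natrD natrB //; ring.
  apply; first by rewrite -[x.+2.+4]/(6 + x)%N ltn_add2r ltnS.
  by rewrite (le_trans rn) // lerDl.
apply: (@drift_step (w0 * L - 1 - x%:R) (s (7 + x)%N) (s (6 + x)%N) (s (5 + x)%N)
  (s (4 + x)%N) (s (3 + x)%N) (s (2 + x)%N) (s (1 + x)%N)) => //.
- by apply: cond => //; rewrite lerBlDr lerDl.
- have := rec x.+1; rewrite -addn1 addnC natE.
  have e m : (m + (1 + x) = m.+1 + x)%N by rewrite addnA addn1.
  by rewrite !e => <-; congr (_ * _); ring.
- by rewrite -(rec x); congr (_ * _); ring.
- exact: (IHi 5%N).
- exact: (IHi 4%N).
- exact: (IHi 3%N).
- exact: (IHi 2%N).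
- exact: (IHi 1%N).
Qed.

End Drift.

(** * Numerical constants for k = 5, 4, 3, 2 *)

(** For every k, [th] = w1 is the least value allowed by [th1], and [mu] = th v1 / w0 the least
    allowed by [mu1]. Here c = 87/50 exceeds T0 / S = 17/11, so P contains a positive multiple of L,
    and stays below 7/4 for the sake of [weight_step_above_mode5]. *)
Lemma drift_cond5 (R : realFieldType) (L r : R) : 58 <= L -> 2 <= r ->
  r <= 15 * L -> drift_cond 1 2 3 4 5 14 (504 / 10) (87 / 50) L r.
Proof.
move=> L_ge r_ge rL; rewrite /drift_cond; cbv zeta.
(* Products of the hypotheses, which make the quadratic goals linear in the monomials. *)
have rr : 0 <= (r - 2) * (r - 2) by rewrite mulr_ge0; lra.
have rl : 0 <= (r - 2) * (15 * L - r) by rewrite mulr_ge0; lra.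
have ll : 0 <= (L - 58) * (15 * L - r) by rewrite mulr_ge0; lra.
have l2 : 0 <= (L - 58) * (L - 58) by rewrite mulr_ge0; lra.
split; [lra | lra | | lra].
(* The subtracted constant is close to the minimiser of the quadratic in r to be bounded. *)
have : 0 <= (r - 769 / 36) * (r - 769 / 36) by rewrite -expr2 sqr_ge0.
lra.
Qed.

(** Now c must lie between T0 / S = 7/6 and the bound 5/4 behind [weight_step_above_mode4]; the
    window is narrow, so S c - T0 is small and a larger [L] is required. *)
Lemma drift_cond4 (R : realFieldType) (L r : R) : 88 <= L -> 2 <= r ->
  r <= 10 * L -> drift_cond 1 2 3 4 0 9 (261 / 10) (56 / 45) L r.
Proof.
move=> L_ge r_ge rL; rewrite /drift_cond; cbv zeta.
have rr : 0 <= (r - 2) * (r - 2) by rewrite mulr_ge0; lra.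
have rl : 0 <= (r - 2) * (10 * L - r) by rewrite mulr_ge0; lra.
have ll : 0 <= (L - 88) * (10 * L - r) by rewrite mulr_ge0; lra.
have l2 : 0 <= (L - 88) * (L - 88) by rewrite mulr_ge0; lra.
split; [lra | lra | | lra].
have : 0 <= (r - 2543 / 200) * (r - 2543 / 200) by rewrite -expr2 sqr_ge0.
lra.
Qed.

Lemma drift_cond3 (R : realFieldType) (L r : R) : 18 <= L -> 1 <= r ->
  r <= 6 * L -> drift_cond 1 2 3 0 0 5 (65 / 6) (99 / 100) L r.
Proof.
move=> L_ge r_ge rL; rewrite /drift_cond; cbv zeta.
have rr : 0 <= (r - 1) * (r - 1) by rewrite mulr_ge0; lra.
have rl : 0 <= (r - 1) * (6 * L - r) by rewrite mulr_ge0; lra.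
have ll : 0 <= (L - 18) * (6 * L - r) by rewrite mulr_ge0; lra.
have l2 : 0 <= (L - 18) * (L - 18) by rewrite mulr_ge0; lra.
split; [lra | lra | | lra].
have : 0 <= (r - 279 / 40) * (r - 279 / 40) by rewrite -expr2 sqr_ge0.
lra.
Qed.

Lemma drift_cond2 (R : realFieldType) (L r : R) : 4 <= L -> 1 <= r ->
  r <= 3 * L -> drift_cond 1 2 0 0 0 2 (8 / 3) (9 / 10) L r.
Proof.
move=> L_ge r_ge rL; rewrite /drift_cond; cbv zeta.
have rr : 0 <= (r - 1) * (r - 1) by rewrite mulr_ge0; lra.
have rl : 0 <= (r - 1) * (3 * L - r) by rewrite mulr_ge0; lra.
have ll : 0 <= (L - 4) * (3 * L - r) by rewrite mulr_ge0; lra.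
have l2 : 0 <= (L - 4) * (L - 4) by rewrite mulr_ge0; lra.
split; [lra | lra | | lra].
have : 0 <= (r - 56 / 15) * (r - 56 / 15) by rewrite -expr2 sqr_ge0.
lra.
Qed.

(** * The mode for large lam *)

Section LargeParameter.
Variables (R : realFieldType) (k lam : nat) (S c : R) (K rm : nat).
Hypotheses (k_gt0 : (0 < k)%N) (lam_gt0 : (0 < lam)%N) (c_lt : c < rm%:R) (S_gt0 : 0 < S).
Local Notation L := (lam%:R : R).
Local Notation h := (poisson_weight L k).
Hypothesis drift : forall n, rm%:R <= K%:R * L + 5 - n%:R ->
    (K%:R * L + 5 - n%:R - c) * padded_weight R k lam n.+1 <=
    S * L * (padded_weight R k lam n.+1 - padded_weight R k lam n).

Lemma weight_drift x : (x.+1 + rm <= K * lam)%N ->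
  (K%:R * L - x.+1%:R - c) * h x.+1 <= S * L * (h x.+1 - h x).
Proof.
move=> xK; have := drift (n := (6 + x)%N).
rewrite /padded_weight ltnNge leq_addr addKn -[(6 + x).+1]addnS ltnNge leq_addr addKn /=.
have -> : K%:R * L + 5 - (6 + x)%:R = K%:R * L - x.+1%:R.
  by rewrite natrD -[x.+1%:R]natr1; ring.
by apply; rewrite lerBrDr -natrM -natrD ler_nat addnC.
Qed.

(** In this range r >= rm > c, so the drift inequality makes every increment strictly positive. *)
Lemma weight_lt x m : (x < m)%N -> (m + rm <= K * lam)%N -> h x < h m.
Proof.
move=> xm mK; have SL_gt0 : 0 < S * L by rewrite mulr_gt0 ?ltr0n.
have step y : (y < m)%N -> h y < h y.+1.
  move=> ym; rewrite -subr_gt0 -(pmulr_rgt0 _ SL_gt0).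
  have yK : (y.+1 + rm <= K * lam)%N by rewrite (leq_trans _ mK) // leq_add2r.
  apply: (lt_le_trans _ (weight_drift yK)); rewrite mulr_gt0 ?poisson_weight_gt0 //.
  by rewrite subr_gt0 (lt_le_trans c_lt) // lerBrDr -natrM -natrD ler_nat addnC.
elim: m xm step {mK} => // m IH; rewrite ltnS leq_eqVlt => /predU1P[->|xm] step.
  exact: step.
by apply: lt_trans (step m _) => //; apply: IH => // y /ltnW; apply: step.
Qed.

Lemma weight_drift_below m i : (m + rm = K * lam)%N -> (i < m)%N ->
  (rm%:R + i%:R - c) * h (m - i) <= S * L * (h (m - i) - h (m - i).-1).
Proof.
move=> mK im; have := weight_drift (x := (m - i).-1).
rewrite prednK ?subn_gt0 // -natrM -mK natrD natrB ?(ltnW im) //.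
have -> : m%:R + rm%:R - (m%:R - i%:R) = rm%:R + i%:R :> R by ring.
by apply; rewrite leq_add2r leq_subr.
Qed.

Lemma weight_mode_of_top m : (m + rm = K * lam)%N ->
  (forall i, (0 < i <= rm)%N -> h (i + m) < h m) ->
  forall x, (x <= K * lam)%N -> x != m -> h x < h m.
Proof.
move=> mK top x; rewrite -mK => xK; case: ltngtP => // xm _.
  by apply: weight_lt => //; rewrite mK.
by rewrite -(subnK (ltnW xm)); apply: top; rewrite subn_gt0 xm leq_subLR.
Qed.

End LargeParameter.

Section PaddedWeight.
Variables (R : realFieldType) (k lam : nat).
Hypotheses (k_gt0 : (0 < k)%N) (lam_gt0 : (0 < lam)%N).

Lemma padded_weight_ge0 n : 0 <= padded_weight R k lam n.
Proof. by rewrite /padded_weight; case: ifP => // _; rewrite ltW ?poisson_weight_gt0. Qed.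

Lemma padded_weight0 n : (n <= 5)%N -> padded_weight R k lam n = 0.
Proof. by rewrite /padded_weight ltnS => ->. Qed.

End PaddedWeight.

Section LargeModes.
Variables (R : realFieldType) (lam : nat).
Local Notation L := (lam%:R : R).

Let rec k := poisson_weight_rec L k.

Lemma weight_mode2 x : (4 <= lam)%N -> (x <= 3 * lam)%N -> x != (3 * lam - 1)%N ->
  poisson_weight L 2 x < poisson_weight L 2 (3 * lam - 1).
Proof.
move=> lam_ge; have lam_gt0 : (0 < lam)%N by lia.
have L_ge : 4 <= L by rewrite ler_nat.
have drift n : 1%:R <= 3%:R * L + 5 - n%:R ->
    (3%:R * L + 5 - n%:R - 9 / 10) * padded_weight R 2 lam n.+1 <=
    5 * L * (padded_weight R 2 lam n.+1 - padded_weight R 2 lam n).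
  (* [drift_bound] expresses K and S through the nested sums w_i; the numerals are put in that
     shape. *)
  have -> : 3%:R = 1 + (2 + (0 + (0 + 0))) :> R by ring.
  have -> : 5 * L =
      (1 + (2 + (0 + (0 + 0))) + (2 + (0 + (0 + 0))) + (0 + (0 + 0)) + (0 + 0) + 0) * L by ring.
  apply: (@drift_bound R 1 2 0 0 0 2 (8 / 3)); rewrite ?ltr0n //; try lra.
  - by move=> r r_ge rL; apply: drift_cond2 => //; lra.
  - exact: padded_weight0.
  - exact: padded_weight_ge0.
  - by move=> y; rewrite padded_weight_rec // !big_ord_recr big_ord0 /= !mul0r !addr0 add0r.
(* With the mode written as q + 4, the range tests and truncated subtractions of the recursion
   compute. *)
have [q qE] : exists q, (3 * lam - 1 = q.+4)%N by exists (3 * lam - 5)%N; lia.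
have mK : (q.+4 + 1 = 3 * lam)%N by lia.
have c_lt : 9 / 10 < 1%:R :> R by lra.
have S_gt0 : 0 < 5 :> R by rewrite ltr0n.
rewrite qE; apply: (weight_mode_of_top _ _ c_lt S_gt0 drift mK) => // -[|[|i]] // _.
have lt3 : poisson_weight L 2 q.+3 < poisson_weight L 2 q.+4.
  by apply: (weight_lt _ _ c_lt S_gt0 drift) => //; rewrite mK.
(* At x = lam K the factor lam cancels, leaving p_x as an average of its predecessors: the mode and
   smaller values. *)
have := rec 2 q.+4; rewrite !big_ord_recr big_ord0 /= !subSS !subn0 add0r.
have -> : q.+1.+4%:R = 3 * L by rewrite -natrM -mK addn1.
rewrite -mulrA mulrCA => /(mulfI (_ : L != 0)); rewrite pnatr_eq0 -lt0n lam_gt0 => /(_ isT).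
rewrite add1n; lra.
Qed.

Lemma weight_mode3 x : (18 <= lam)%N -> (x <= 6 * lam)%N -> x != (6 * lam - 1)%N ->
  poisson_weight L 3 x < poisson_weight L 3 (6 * lam - 1).
Proof.
move=> lam_ge; have lam_gt0 : (0 < lam)%N by lia.
have L_ge : 18 <= L by rewrite ler_nat.
have drift n : 1%:R <= 6%:R * L + 5 - n%:R ->
    (6%:R * L + 5 - n%:R - 99 / 100) * padded_weight R 3 lam n.+1 <=
    14 * L * (padded_weight R 3 lam n.+1 - padded_weight R 3 lam n).
  have -> : 6%:R = 1 + (2 + (3 + (0 + 0))) :> R by ring.
  have -> : 14 * L =
      (1 + (2 + (3 + (0 + 0))) + (2 + (3 + (0 + 0))) + (3 + (0 + 0)) + (0 + 0) + 0) * L by ring.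
  apply: (@drift_bound R 1 2 3 0 0 5 (65 / 6)); rewrite ?ltr0n //; try lra.
  - by move=> r r_ge rL; apply: drift_cond3 => //; lra.
  - exact: padded_weight0.
  - exact: padded_weight_ge0.
  - by move=> y; rewrite padded_weight_rec // !big_ord_recr big_ord0 /= !mul0r !addr0 add0r.
have [q qE] : exists q, (6 * lam - 1 = q.+4)%N by exists (6 * lam - 5)%N; lia.
have mK : (q.+4 + 1 = 6 * lam)%N by lia.
have c_lt : 99 / 100 < 1%:R :> R by lra.
have S_gt0 : 0 < 14 :> R by rewrite ltr0n.
rewrite qE; apply: (weight_mode_of_top _ _ c_lt S_gt0 drift mK) => // -[|[|i]] // _.
have lt y : (y < q.+4)%N -> poisson_weight L 3 y < poisson_weight L 3 q.+4.
  by move=> yq; apply: (weight_lt _ _ c_lt S_gt0 drift) => //; rewrite mK.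
have lt3 := lt q.+3 (leqnn _); have lt2 := lt q.+2 (leqW (leqnn _)).
have := rec 3 q.+4; rewrite !big_ord_recr big_ord0 /= !subSS !subn0 add0r.
have -> : q.+1.+4%:R = 6 * L by rewrite -natrM -mK addn1.
rewrite -mulrA mulrCA => /(mulfI (_ : L != 0)); rewrite pnatr_eq0 -lt0n lam_gt0 => /(_ isT).
rewrite add1n; lra.
Qed.

(** Here s0 belongs to lam K - 1 and s1 to the mode. If s0 >= s1, the recursion bounds the
    w_i-weighted increments below the mode by s1 / l, slightly less than the drift inequalities
    force. *)
Lemma weight_step_above_mode4 (l s0 s1 s2 s3 s4 : R) : 88 <= l ->
  0 < s0 -> 0 < s1 -> 0 < s2 -> 0 < s3 -> 0 < s4 ->
  (10 * l - 1) * s0 = l * (1 * s1 + 2 * s2 + 3 * s3 + 4 * s4) ->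
  (2 - 56 / 45) * s1 <= 30 * l * (s1 - s2) ->
  (3 - 56 / 45) * s2 <= 30 * l * (s2 - s3) ->
  (4 - 56 / 45) * s3 <= 30 * l * (s3 - s4) -> s0 < s1.
Proof.
move=> l_ge p0 p1 p2 p3 p4 e d1 d2 d3; rewrite ltNge; apply/negP => s01.
have A : l * (9 * (s1 - s2) + 7 * (s2 - s3) + 4 * (s3 - s4)) <= s1.
  have : (10 * l - 1) * s1 <= (10 * l - 1) * s0 by rewrite ler_wpM2l //; lra.
  lra.
have l_gt0 : 0 < l by lra.
have m1 : s2 <= s1 by rewrite -subr_ge0 -(pmulr_rge0 _ l_gt0); lra.
have m2 : s3 <= s2 by rewrite -subr_ge0 -(pmulr_rge0 _ l_gt0); lra.
(* If s1 = s2 = s3, drift would give 9 (2 - c) + 7 (3 - c) + 4 (4 - c) = 55 - 20 c > 30.1 where [A]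
   allows S = 30. So s1 - s3 is at least a fixed fraction of s1, but [A] makes it O(s1 / l). *)
have B : 1 / 10 * s1 <= 24 * (s1 - s3) by lra.
have : l * (1 / 10 * s1) <= l * (24 * (s1 - s3)) by rewrite ler_pM2l.
have : 88 * s1 <= l * s1 by rewrite ler_pM2r.
lra.
Qed.

Lemma weight_step_above_mode5 (l s0 s1 s2 s3 s4 s5 : R) : 58 <= l ->
  0 < s0 -> 0 < s1 -> 0 < s2 -> 0 < s3 -> 0 < s4 ->
  (15 * l - 1) * s0 = l * (1 * s1 + 2 * s2 + 3 * s3 + 4 * s4 + 5 * s5) ->
  (2 - 87 / 50) * s1 <= 55 * l * (s1 - s2) ->
  (3 - 87 / 50) * s2 <= 55 * l * (s2 - s3) ->
  (4 - 87 / 50) * s3 <= 55 * l * (s3 - s4) ->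
  (5 - 87 / 50) * s4 <= 55 * l * (s4 - s5) -> s0 < s1.
Proof.
move=> l_ge p0 p1 p2 p3 p4 e d1 d2 d3 d4; rewrite ltNge; apply/negP => s01.
have A : l * (14 * (s1 - s2) + 12 * (s2 - s3) + 9 * (s3 - s4) + 5 * (s4 - s5)) <= s1.
  have : (15 * l - 1) * s1 <= (15 * l - 1) * s0 by rewrite ler_wpM2l //; lra.
  lra.
have l_gt0 : 0 < l by lra.
have m1 : s2 <= s1 by rewrite -subr_ge0 -(pmulr_rge0 _ l_gt0); lra.
have m4 : s5 <= s4 by rewrite -subr_ge0 -(pmulr_rge0 _ l_gt0); lra.
have m2 : s3 <= s2 by rewrite -subr_ge0 -(pmulr_rge0 _ l_gt0); lra.
have m3 : s4 <= s3 by rewrite -subr_ge0 -(pmulr_rge0 _ l_gt0); lra.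
(* As for k = 4, with 125 - 40 c = 55.4 against S = 55. *)
have B : 4 / 10 * s1 <= 53 * (s1 - s4) by lra.
have : l * (4 / 10 * s1) <= l * (53 * (s1 - s4)) by rewrite ler_pM2l.
have : 58 * s1 <= l * s1 by rewrite ler_pM2r.
lra.
Qed.

Lemma weight_mode4 x : (88 <= lam)%N -> (x <= 10 * lam)%N -> x != (10 * lam - 2)%N ->
  poisson_weight L 4 x < poisson_weight L 4 (10 * lam - 2).
Proof.
move=> lam_ge; have lam_gt0 : (0 < lam)%N by lia.
have L_ge : 88 <= L by rewrite ler_nat.
have drift n : 2%:R <= 10%:R * L + 5 - n%:R ->
    (10%:R * L + 5 - n%:R - 56 / 45) * padded_weight R 4 lam n.+1 <=
    30 * L * (padded_weight R 4 lam n.+1 - padded_weight R 4 lam n).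
  have -> : 10%:R = 1 + (2 + (3 + (4 + 0))) :> R by ring.
  have -> : 30 * L =
      (1 + (2 + (3 + (4 + 0))) + (2 + (3 + (4 + 0))) + (3 + (4 + 0)) + (4 + 0) + 0) * L by ring.
  apply: (@drift_bound R 1 2 3 4 0 9 (261 / 10)); rewrite ?ltr0n //; try lra.
  - by move=> r r_ge rL; apply: drift_cond4 => //; lra.
  - exact: padded_weight0.
  - exact: padded_weight_ge0.
  - by move=> y; rewrite padded_weight_rec // !big_ord_recr big_ord0 /= !mul0r !addr0 add0r.
have [q qE] : exists q, (10 * lam - 2 = q.+4)%N by exists (10 * lam - 6)%N; lia.
have mK : (q.+4 + 2 = 10 * lam)%N by lia.
have c_lt : 56 / 45 < 2%:R :> R by lra.
have S_gt0 : 0 < 30 :> R by rewrite ltr0n.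
rewrite qE; apply: (weight_mode_of_top _ _ c_lt S_gt0 drift mK) => //.
have lt y : (y < q.+4)%N -> poisson_weight L 4 y < poisson_weight L 4 q.+4.
  by move=> yq; apply: (weight_lt _ _ c_lt S_gt0 drift) => //; rewrite mK.
have below j := weight_drift_below drift (i := j) mK.
have pos y : 0 < poisson_weight L 4 y by apply: poisson_weight_gt0.
have topE : q.+2.+4%:R = 10 * L by rewrite -natrM -mK addn2.
have lt5 : poisson_weight L 4 q.+1.+4 < poisson_weight L 4 q.+4.
  have := rec 4 q.+4; rewrite !big_ord_recr big_ord0 /= !subSS !subn0 add0r.
  have -> : q.+1.+4%:R = 10 * L - 1 by rewrite -topE -[q.+2.+4%:R]natr1 addrK.
  move: (below 0%N isT) (below 1%N isT) (below 2%N isT) (below 3%N isT).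
  rewrite !subSS !subn0 /= mulr0n addr0 => b0 b1 b2 b3 e.
  apply: (weight_step_above_mode4 L_ge _ _ _ _ _ e); rewrite ?pos //; lra.
(* [lt5] settles lam K - 1; the point lam K is again an average of its predecessors. *)
move=> -[|[|[|i]]] // _; rewrite ?add1n ?add2n //.
have lt3 := lt q.+3 (leqnn _); have lt2 := lt q.+2 (leqW (leqnn _)).
have lt1 : poisson_weight L 4 q.+1 < poisson_weight L 4 q.+4 by apply: lt; lia.
have := rec 4 q.+1.+4; rewrite !big_ord_recr big_ord0 /= !subSS !subn0 add0r topE.
rewrite -mulrA mulrCA => /(mulfI (_ : L != 0)); rewrite pnatr_eq0 -lt0n lam_gt0 => /(_ isT).
lra.
Qed.

Lemma weight_mode5 x : (58 <= lam)%N -> (x <= 15 * lam)%N -> x != (15 * lam - 2)%N ->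
  poisson_weight L 5 x < poisson_weight L 5 (15 * lam - 2).
Proof.
move=> lam_ge; have lam_gt0 : (0 < lam)%N by lia.
have L_ge : 58 <= L by rewrite ler_nat.
have drift n : 2%:R <= 15%:R * L + 5 - n%:R ->
    (15%:R * L + 5 - n%:R - 87 / 50) * padded_weight R 5 lam n.+1 <=
    55 * L * (padded_weight R 5 lam n.+1 - padded_weight R 5 lam n).
  have -> : 15%:R = 1 + (2 + (3 + (4 + 5))) :> R by ring.
  have -> : 55 * L =
      (1 + (2 + (3 + (4 + 5))) + (2 + (3 + (4 + 5))) + (3 + (4 + 5)) + (4 + 5) + 5) * L by ring.
  apply: (@drift_bound R 1 2 3 4 5 14 (504 / 10)); rewrite ?ltr0n //; try lra.
  - by move=> r r_ge rL; apply: drift_cond5 => //; lra.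
  - exact: padded_weight0.
  - exact: padded_weight_ge0.
  - by move=> y; rewrite padded_weight_rec // !big_ord_recr big_ord0 /= add0r.
have [q qE] : exists q, (15 * lam - 2 = q.+4)%N by exists (15 * lam - 6)%N; lia.
have mK : (q.+4 + 2 = 15 * lam)%N by lia.
have c_lt : 87 / 50 < 2%:R :> R by lra.
have S_gt0 : 0 < 55 :> R by rewrite ltr0n.
rewrite qE; apply: (weight_mode_of_top _ _ c_lt S_gt0 drift mK) => //.
have lt y : (y < q.+4)%N -> poisson_weight L 5 y < poisson_weight L 5 q.+4.
  by move=> yq; apply: (weight_lt _ _ c_lt S_gt0 drift) => //; rewrite mK.
have below j := weight_drift_below drift (i := j) mK.
have pos y : 0 < poisson_weight L 5 y by apply: poisson_weight_gt0.
have topE : q.+2.+4%:R = 15 * L by rewrite -natrM -mK addn2.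
have lt5 : poisson_weight L 5 q.+1.+4 < poisson_weight L 5 q.+4.
  have := rec 5 q.+4; rewrite !big_ord_recr big_ord0 /= !subSS !subn0 add0r.
  have -> : q.+1.+4%:R = 15 * L - 1 by rewrite -topE -[q.+2.+4%:R]natr1 addrK.
  move: (below 0%N isT) (below 1%N isT) (below 2%N isT) (below 3%N isT).
  rewrite !subSS !subn0 /= mulr0n addr0 => b0 b1 b2 b3 e.
  apply: (weight_step_above_mode5 L_ge _ _ _ _ _ e); rewrite ?pos //; lra.
move=> -[|[|[|i]]] // _; rewrite ?add1n ?add2n //.
have lt3 := lt q.+3 (leqnn _); have lt2 := lt q.+2 (leqW (leqnn _)).
have lt1 : poisson_weight L 5 q.+1 < poisson_weight L 5 q.+4 by apply: lt; lia.
have := rec 5 q.+1.+4; rewrite !big_ord_recr big_ord0 /= !subSS !subn0 add0r topE.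
rewrite -mulrA mulrCA => /(mulfI (_ : L != 0)); rewrite pnatr_eq0 -lt0n lam_gt0 => /(_ isT).
lra.
Qed.

End LargeModes.

(** * Integer enclosures for the finitely many remaining lam *)

Fixpoint dotN (ws s : seq N) : N :=
  match ws, s with
  | w :: ws', a :: s' => N.add (N.mul w a) (dotN ws' s')
  | _, _ => N0
  end.

(* Bounds for C p_n, ..., C p_(n-4), most recent first, where n + 1 = step_index and C > 0
   is some scale, together with an upper bound for all C p_i with i < n. *)
Record enclosure := Enclosure {
  step_index : N;
  lower : seq N;
  upper : seq N;
  past_max : N
}.

(* Keeps the entries short; the lower digits are not needed to separate the mode. *)
Definition rescale (e : enclosure) : enclosure :=
  let: Enclosure x l u M := e in
  if N.ltb (N.pow 2 48) (head N0 l) then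
    let down a := N.div a (N.pow 2 16) in
    let up a := N.succ (N.div a (N.pow 2 16)) in
    Enclosure x (map down l) (map up u) (up M)
  else e.

(** The recursion solved for the next weight, rounded outwards; five entries suffice as k <= 5. *)
Definition advance (lam : N) (ws : seq N) (e : enclosure) : enclosure :=
  let: Enclosure x l u M := e in
  Enclosure (N.succ x)
    (N.div (N.mul lam (dotN ws l)) x :: take 4 l)
    (N.succ (N.div (N.mul lam (dotN ws u)) x) :: take 4 u)
    (N.max M (head N0 u)).

Definition enclosure_step (lam : N) (ws : seq N) (e : enclosure) : enclosure :=
  rescale (advance lam ws e).

(** The start encloses C p_0 with C = 2^32. The first run stops at the mode, where [past_max] covers
    all smaller indices. The second ends at K lam, where entry [rm] is the mode and the entries
    before it are the later points. *)
Definition mode_check (k K rm lam : nat) : bool :=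
  let next := enclosure_step (N.of_nat lam) (map N.of_nat (iota 1 k)) in
  let e := iter (K * lam - rm) next (Enclosure 1 [:: N.pow 2 32] [:: N.pow 2 32] 0) in
  let: Enclosure _ l u _ := iter rm next e in
  N.ltb (past_max e) (head N0 (lower e)) &&
  all (fun j => N.ltb (nth N0 u j) (nth N0 l rm)) (iota 0 rm).

Section Correctness.
Variables (R : realFieldType) (k lam : nat).
Hypotheses (k_le5 : (k <= 5)%N).
Local Notation L := (lam%:R : R).
Let toR (a : N) : R := (N.to_nat a)%:R.

Lemma toR_dotN ws s :
  toR (dotN ws s) = \sum_(i < size ws) toR (nth N0 ws i) * toR (nth N0 s i).
Proof.
elim: ws s => [|w ws IH] [|a s] /=; rewrite ?big_ord0 //.
  by rewrite big1 // => i _; rewrite nth_nil mulr0.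
by rewrite big_ord_recl /= -IH /toR N2Nat.inj_add N2Nat.inj_mul natrD natrM.
Qed.

Lemma toR_div (a b : N) (c : R) : (0 < N.to_nat b)%N ->
  (toR a <= c * toR b -> toR (N.div a b) <= c) /\
  (c * toR b <= toR a -> c <= toR (N.succ (N.div a b))).
Proof.
move=> b_gt0.
have [le_a a_le] : toR (N.div a b) * toR b <= toR a /\
    toR a <= toR (N.succ (N.div a b)) * toR b.
  rewrite /toR -!natrM !ler_nat N2Nat.inj_succ N2Nat.inj_div.
  have := PeanoNat.Nat.div_mod_eq (N.to_nat a) (N.to_nat b).
  have := PeanoNat.Nat.mod_upper_bound (N.to_nat a) (N.to_nat b).
  by nia.
have b_gt0' : 0 < toR b by rewrite ltr0n.
split=> ac; rewrite -(ler_pM2r b_gt0'); first exact: le_trans le_a ac.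
exact: le_trans ac a_le.
Qed.

Lemma toR_weighted_sum s :
  toR (N.mul (N.of_nat lam) (dotN (map N.of_nat (iota 1 k)) s)) =
  L * \sum_(i < k) i.+1%:R * toR (nth N0 s i).
Proof.
rewrite /toR N2Nat.inj_mul natrM Nat2N.id -/(toR (dotN _ _)) toR_dotN size_map size_iota.
congr (_ * _); apply: eq_bigr => i _; congr (_ * _).
by rewrite (nth_map 0%N) ?size_iota // nth_iota // /toR Nat2N.id add1n.
Qed.

(** The scale is existential because rescaling changes it; only values at a common scale are
    compared. *)
Definition encloses (n : nat) (e : enclosure) : Prop :=
  step_index e = N.of_nat n.+1 /\
  exists2 C : R, 0 < C &
    (forall j, (j < 5)%N -> toR (nth N0 (lower e) j) <=
       C * padded_weight R k lam (6 + n - j) <= toR (nth N0 (upper e) j)) /\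
    (forall i, (i < n)%N -> C * poisson_weight L k i <= toR (past_max e)).

Lemma rescaleP n e : encloses n e -> encloses n (rescale e).
Proof.
case: e => x l u M; rewrite /rescale; case: ifP => // _ [/= xE [C C_gt0 [lu maxM]]].
pose b := N.pow 2 16.
have b_gt0 : (0 < N.to_nat b)%N.
  by rewrite lt0n; apply/eqP => /(f_equal N.of_nat); rewrite N2Nat.id.
have b_neq0 : toR b != 0 by rewrite pnatr_eq0 -lt0n.
have b_ge0 : 0 <= (toR b)^-1 by rewrite invr_ge0 ler0n.
have down a c : toR a <= c -> toR (N.div a b) <= c / toR b.
  by move=> ac; apply: (toR_div a _ b_gt0).1; rewrite divfK.
have up a c : c <= toR a -> c / toR b <= toR (N.succ (N.div a b)).
  by move=> ac; apply: (toR_div a _ b_gt0).2; rewrite divfK.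
split=> //; exists (C / toR b); first by rewrite divr_gt0 // lt_def b_neq0 ler0n.
split=> [j j5|i i_n] /=; rewrite mulrAC; last by apply: up; apply: maxM.
have /andP[l_le le_u] := lu j j5.
apply/andP; split.
  have [jl|lj] := ltnP j (size l); first by rewrite (nth_map N0) //; apply: down.
  rewrite nth_default ?size_map //; rewrite nth_default // in l_le.
  by rewrite mulr_ge0.
(* Beyond the list the default stays 0, whereas [up] would send 0 to 1; there the enclosed value is
   at most 0. *)
have [ju|uj] := ltnP j (size u); first by rewrite (nth_map N0) //; apply: up.
rewrite nth_default ?size_map //; rewrite nth_default // in le_u.
by rewrite mulr_le0_ge0.
Qed.

Lemma enclosure_stepP n e : encloses n e ->
  encloses n.+1 (enclosure_step (N.of_nat lam) (map N.of_nat (iota 1 k)) e).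
Proof.
case: e => x l u M [/= -> [C C_gt0 [lu maxM]]]; apply: rescaleP.
split=> //.
exists C => //; split=> [[|j] j5|i]; last first.
- rewrite ltnS leq_eqVlt => /predU1P[->|i_n] /=.
    have /andP[_] := lu 0 isT.
    rewrite subn0 {1}/padded_weight ltnNge leq_addr addKn nth0 => le_u.
    apply: le_trans le_u _; rewrite /toR ler_nat N2Nat.inj_max; lia.
  by apply: le_trans (maxM i i_n) _; rewrite /toR ler_nat N2Nat.inj_max; lia.
- by rewrite /= addnS subSS !nth_take //; apply: lu; rewrite ltnW.
rewrite /lower /upper subn0.
have rec := @padded_weight_rec R k lam n.+1 k_le5.
have sumE : C * padded_weight R k lam (6 + n.+1) * toR (N.of_nat n.+1) =
    L * \sum_(i < k) i.+1%:R * (C * padded_weight R k lam (6 + n - i)).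
  rewrite /toR Nat2N.id -mulrA [_ * n.+1%:R]mulrC rec mulrCA mulr_sumr; congr (_ * _).
  by apply: eq_bigr => i _; rewrite mulrCA addnS.
have sum_le (f g : nat -> R) : (forall i, (i < 5)%N -> f i <= g i) ->
    L * (\sum_(i < k) i.+1%:R * f i) <= L * (\sum_(i < k) i.+1%:R * g i).
  move=> fg; rewrite ler_wpM2l ?ler0n //; apply: ler_sum => i _.
  by rewrite ler_wpM2l ?ler0n // fg // (leq_trans (ltn_ord i)).
pose q i := C * padded_weight R k lam (6 + n - i).
have n_gt0 : (0 < N.to_nat (N.of_nat n.+1))%N by rewrite Nat2N.id.
have div a := @toR_div a _ (C * padded_weight R k lam (6 + n.+1)) n_gt0.
apply/andP; split; [apply: (div _).1 | apply: (div _).2]; rewrite sumE toR_weighted_sum.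
  by apply: (sum_le (fun i => toR (nth N0 l i)) q) => i /lu/andP[].
by apply: (sum_le q (fun i => toR (nth N0 u i))) => i /lu/andP[].
Qed.

Lemma iter_enclosureP n e i : encloses n e ->
  encloses (i + n) (iter i (enclosure_step (N.of_nat lam) (map N.of_nat (iota 1 k))) e).
Proof. by move=> ne; elim: i => // i IH; apply: enclosure_stepP. Qed.

Lemma mode_checkP K rm : mode_check k K rm lam -> (rm < 5)%N -> (rm <= K * lam)%N ->
  forall x, (x <= K * lam)%N -> x != (K * lam - rm)%N ->
  poisson_weight L k x < poisson_weight L k (K * lam - rm).
Proof.
rewrite /mode_check => chk rm5 rmK x xK xm; move: chk.
set e0 := Enclosure _ _ _ _; set next := enclosure_step _ _.
have e0P : encloses 0 e0.
  split=> //; exists (toR (N.pow 2 32)).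
    by rewrite /toR ltr0n lt0n; apply/eqP => /(f_equal N.of_nat); rewrite N2Nat.id.
  split=> // -[|j] _; last by rewrite /= !nth_nil padded_weight0 ?mulr0 ?lexx //; lia.
  by rewrite /padded_weight /= poisson_weight0 mulr1 lexx.
have e1P := iter_enclosureP (K * lam - rm) e0P; rewrite addn0 -/next in e1P.
have e2P := iter_enclosureP rm e1P; rewrite -/next in e2P.
have ltR a b : N.ltb a b -> toR a < toR b.
  move/N.ltb_lt => ab; rewrite /toR ltr_nat; apply/ssrnat.ltP; move: ab.
  by rewrite /N.lt N2Nat.inj_compare PeanoNat.Nat.compare_lt_iff.
move: e1P e2P; set e1 := iter (K * lam - rm) next e0; move=> [_ [C C_gt0 [lu maxM]]].
case: (iter rm next e1) => x' l u M [_ [C' C'_gt0 [/= lu' _]]] /andP[lt1 /allP lt2].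
have padE n : padded_weight R k lam (6 + n) = poisson_weight L k n.
  by rewrite /padded_weight ltnNge leq_addr addKn.
have [xlt|xgt|/eqP] := ltngtP x (K * lam - rm); last by rewrite (negPf xm).
  rewrite -(ltr_pM2l C_gt0); apply: le_lt_trans (maxM _ xlt) _.
  have /andP[+ _] := lu 0 isT; rewrite subn0 padE nth0; apply: lt_le_trans.
  exact: ltR.
rewrite subnKC // in lu'.
have j_rm : (K * lam - x < rm)%N by lia.
have /ltR lt_rm : N.ltb (nth N0 u (K * lam - x)) (nth N0 l rm).
  by apply: lt2; rewrite mem_iota.
have /andP[_ xu] := lu' _ (ltn_trans j_rm rm5); have /andP[lm _] := lu' _ rm5.
rewrite -addnBA ?leq_subr // subKn // padE in xu; rewrite -addnBA // padE in lm.
rewrite -(ltr_pM2l C'_gt0).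
exact: le_lt_trans xu (lt_le_trans lt_rm lm).
Qed.

End Correctness.

(** This and the next three checks cover exactly the positive lam below the thresholds 4, 18, 88 and
    58. *)
Lemma mode_check2 : all (mode_check 2 3 1) (iota 1 3).
Proof. vm_cast_no_check (erefl true). Qed.

Lemma mode_check3 : all (mode_check 3 6 1) (iota 1 17).
Proof. vm_cast_no_check (erefl true). Qed.

Lemma mode_check4 : all (mode_check 4 10 2) (iota 1 87).
Proof. vm_cast_no_check (erefl true). Qed.

Lemma mode_check5 : all (mode_check 5 15 2) (iota 1 57).
Proof. vm_cast_no_check (erefl true). Qed.

(** * Assembly of the small and large cases, and return to the pmf *)

Lemma weight_mode (R : realFieldType) (k lam x : nat) :
  (0 < lam)%N -> (2 <= k <= 5)%N ->
  x != (lam * (k * k.+1) %/ 2 - k %/ 2)%N ->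
  poisson_weight (lam%:R : R) k x <
  poisson_weight (lam%:R : R) k (lam * (k * k.+1) %/ 2 - k %/ 2).
Proof.
move=> lam_gt0 k25; have k_gt0 : (0 < k)%N by case/andP: k25 => /ltnW.
move: x; apply: poisson_weight_mode => // x.
have small K rm n : all (mode_check k K rm) (iota 1 n) ->
    (lam < n.+1)%N -> mode_check k K rm lam.
  by move=> /allP chk lam_n; apply: chk; rewrite mem_iota lam_gt0.
have sumE n : (\sum_(i < n) i.+1)%N = (n * n.+1 %/ 2)%N.
  elim: n => [|n IH]; rewrite ?big_ord0 // big_ord_recr /= IH; nia.
have halfE c : (lam * (c * 2) %/ 2 = c * lam)%N by rewrite mulnA mulnK // mulnC.
rewrite sumE; move: small; case: k k_gt0 k25 => [|[|[|[|[|[|k]]]]]] // _ _ small.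
- rewrite -[(2 * 3)%N]/(3 * 2)%N halfE mulnK // (mulnC lam) -[(2 %/ 2)%N]/1%N.
  have [lam_small|lam_large] := ltnP lam 4; last exact: weight_mode2.
  by apply: mode_checkP => //; [exact: small mode_check2 lam_small | lia].
- rewrite -[(3 * 4)%N]/(6 * 2)%N halfE mulnK // (mulnC lam) -[(3 %/ 2)%N]/1%N.
  have [lam_small|lam_large] := ltnP lam 18; last exact: weight_mode3.
  by apply: mode_checkP => //; [exact: small mode_check3 lam_small | lia].
- rewrite -[(4 * 5)%N]/(10 * 2)%N halfE mulnK // (mulnC lam) -[(4 %/ 2)%N]/2%N.
  have [lam_small|lam_large] := ltnP lam 88; last exact: weight_mode4.
  by apply: mode_checkP => //; [exact: small mode_check4 lam_small | lia].
- rewrite -[(5 * 6)%N]/(15 * 2)%N halfE mulnK // (mulnC lam) -[(5 %/ 2)%N]/2%N.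
  have [lam_small|lam_large] := ltnP lam 58; last exact: weight_mode5.
  by apply: mode_checkP => //; [exact: small mode_check5 lam_small | lia].
Qed.

Lemma poisson_order_pmfE (R : realType) k (lam : R) x :
  poisson_order_pmf k lam x = expR (- (k%:R * lam)) * poisson_weight lam k x.
Proof.
rewrite /poisson_order_pmf /poisson_weight coef_gen_poly mulr_sumr.
by apply: eq_bigr => t _; rewrite mulrA.
Qed.

(* For a positive integer lam and k in {2,3,4,5}, the set of modes of the
   Poisson distribution of order k with parameter lam is exactly
   {lam*k*(k+1)/2 - floor(k/2)}. *)
Theorem theorem2p2 (R : realType) (lam k : nat) :
  (0 < lam)%N -> (2 <= k <= 5)%N ->
  forall x : nat,
    (forall y : nat, poisson_order_pmf k (lam%:R : R) y <= poisson_order_pmf k (lam%:R : R) x)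
    <-> x = (lam * (k * k.+1) %/ 2 - k %/ 2)%N.
Proof.
move=> lam_gt0 k25 x; have lt_mode := weight_mode R lam_gt0 k25.
have leE y z : (poisson_order_pmf k (lam%:R : R) y <= poisson_order_pmf k (lam%:R : R) z)
    = (poisson_weight (lam%:R : R) k y <= poisson_weight (lam%:R : R) k z).
  by rewrite !poisson_order_pmfE ler_pM2l ?expR_gt0.
split=> [x_max|-> y]; last first.
  by rewrite leE; have [->//|/lt_mode/ltW] := eqVneq y (lam * (k * k.+1) %/ 2 - k %/ 2)%N.
apply/eqP/negPn/negP => /lt_mode.
by rewrite ltNge -leE x_max.
Qed.
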